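(* Let $\hat{\boldsymbol\theta}$ be the MAP estimate of the skills in the adjacent categories (AC) model with constant-sum slopes and a zero-mean Gaussian prior of precision $\gamma>0$, and let $s_i=\sum_y\delta_yk_{y;i}$ be the scores. Let $i\neq j$ be two players. If the pair $(i,j)$ is schedule-equivalent and the schedule is venue-balanced for $i$ and for $j$, then their score and skill orders agree: $$s_i\ge s_j\iff\hat\theta_i\ge\hat\theta_j .$$ If the model is venue-neutral (no home advantage), then schedule equivalence of the pair $(i,j)$ alone guarantees $s_i\ge s_j\iff\hat\theta_i\ge\hat\theta_j$.
   Context: Players $1,\dots,M$ with real skills $\theta_1,\dots,\theta_M$ play one-on-one matches, each having a host and a visitor. Outcomes lie in $\{0,\dots,L-1\}$, $L\ge2$; if the host's outcome is $y$, the visitor's is $L-1-y$. Counts. $k^{\mathrm h}_{y;i,j}$ is the number of matches hosted by $i$ against $j$ that ended in $i$'s outcome $y$; $k^{\mathrm a}_{y;i,j}=k^{\mathrm h}_{L-1-y;j,i}$ is the number of matches in which $i$ visited $j$ with $i$'s outcome $y$; $k_{y;i}=\sum_j(k^{\mathrm h}_{y;i,j}+k^{\mathrm a}_{y;i,j})$; $k^{\mathrm h}_{i,j}=\sum_yk^{\mathrm h}_{y;i,j}$; $k^{\mathrm a}_{i,j}=\sum_yk^{\mathrm a}_{y;i,j}=k^{\mathrm h}_{j,i}$; $k_{i,j}=k^{\mathrm h}_{i,j}+k^{\mathrm a}_{i,j}=k_{j,i}$. Schedule conditions. The pair $(i,j)$ is schedule-equivalent if $k_{i,l}=k_{j,l}$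 for all $l\ne i,j$. The schedule is venue-balanced for player $i$ if $k^{\mathrm h}_{i,l}=k^{\mathrm a}_{i,l}$ for every $l$. AC model with constant-sum slopes. When $i$ hosts $j$, $i$'s outcome is $y$ with probability $\mathsf{P}^{\mathrm h}_y(\theta_i-\theta_j)$, where $$\mathsf{P}^{\mathrm h}_y(z)=\frac{e^{\alpha^{\mathrm h}_y+\delta_yz}}{\sum_{l=0}^{L-1}e^{\alpha^{\mathrm h}_l+\delta_lz}},$$ with given real intercepts $\alpha^{\mathrm h}_y$ and given slopes $0=\delta_0\le\delta_1\le\dots\le\delta_{L-1}=1$ satisfying $\delta_y+\delta_{L-1-y}=1$ for all $y$. The away probabilities are $\mathsf{P}^{\mathrm a}_y(z)=\mathsf{P}^{\mathrm h}_{L-1-y}(-z)$. The model is venue-neutral (no home advantage) if $\mathsf{P}^{\mathrm h}_y=\mathsf{P}^{\mathrm a}_y$ for all $y$. The score-points are the slopes, so the score of player $i$ is $s_i=\sum_y\delta_yk_{y;i}$. MAP estimate. $\hat{\boldsymbol\theta}$ is the (unique) maximizer over $\boldsymbol\theta\in\mathbb{R}^M$ of $$\sum_{i,j}\sum_yk^{\mathrm h}_{y;i,j}\log\mathsf{P}^{\mathrm h}_y(\theta_i-\theta_j)-\frac{\gamma}{2}\sum_i\theta_i^2,\qquad\gamma>0.$$ *)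

(* Defs.v *)
From HB Require Import structures.
From mathcomp Require Import all_boot all_order all_algebra.
From mathcomp Require Import reals.
From mathcomp.analysis Require Import sequences exp.

Set Implicit Arguments.
Unset Strict Implicit.
Unset Printing Implicit Defensive.

Import Order.TTheory GRing.Theory Num.Theory.
Local Open Scope ring_scope.

(* Outcomes are indexed by 'I_L and players by 'I_M; [rev_ord y] is the
   outcome L - 1 - y. *)

Section Counts.
Variables (L M : nat).

(* [kh y i j] : matches hosted by i against j that ended in i's outcome y. *)
Definition counts := 'I_L -> 'I_M -> 'I_M -> nat.

Variable kh : counts.

(* Needed because i = j is allowed by the type: a self-match would add to the
   score of i while carrying no information on its skill. *)
Definition no_self_match : Prop := forall y i, kh y i i = 0%N.

(* i is the visitor and y is the outcome of i. *)
Definition away_count (y : 'I_L) (i j : 'I_M) : nat := kh (rev_ord y) j i.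

Definition outcome_count (y : 'I_L) (i : 'I_M) : nat :=
  (\sum_(j < M) (kh y i j + away_count y i j))%N.

Definition home_matches (i j : 'I_M) : nat := (\sum_(y < L) kh y i j)%N.

Definition away_matches (i j : 'I_M) : nat := (\sum_(y < L) away_count y i j)%N.

Definition matches (i j : 'I_M) : nat :=
  (home_matches i j + away_matches i j)%N.

Definition schedule_equivalent (i j : 'I_M) : Prop :=
  forall l : 'I_M, l != i -> l != j -> matches i l = matches j l.

Definition venue_balanced (i : 'I_M) : Prop :=
  forall l : 'I_M, home_matches i l = away_matches i l.

End Counts.

Section Model.
Variables (R : realType) (L : nat).

Definition constant_sum_slopes (delta : 'I_L -> R) : Prop :=
  [/\ forall y : 'I_L, y = 0%N :> nat -> delta y = 0,
      forall y : 'I_L, y = L.-1 :> nat -> delta y = 1,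
      forall y y' : 'I_L, (y <= y')%N -> delta y <= delta y'
    & forall y : 'I_L, delta y + delta (rev_ord y) = 1].

Variables alpha delta : 'I_L -> R.

Definition home_prob (y : 'I_L) (z : R) : R :=
  expR (alpha y + delta y * z) / \sum_(l < L) expR (alpha l + delta l * z).

Definition away_prob (y : 'I_L) (z : R) : R := home_prob (rev_ord y) (- z).

Definition venue_neutral : Prop :=
  forall (y : 'I_L) (z : R), home_prob y z = away_prob y z.

Variables (M : nat) (kh : counts L M).

Definition score (i : 'I_M) : R :=
  \sum_(y < L) delta y * (outcome_count kh y i)%:R.

(* Up to an additive constant independent of theta. *)
Definition log_posterior (gamma : R) (theta : 'rV[R]_M) : R :=
  \sum_(i < M) \sum_(j < M) \sum_(y < L)
    (kh y i j)%:R * ln (home_prob y (theta ord0 i - theta ord0 j))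
  - gamma / 2 * \sum_(i < M) theta ord0 i ^+ 2.

Definition is_MAP (gamma : R) (theta_hat : 'rV[R]_M) : Prop :=
  forall theta : 'rV[R]_M,
    log_posterior gamma theta <= log_posterior gamma theta_hat.

End Model.

(* Main.v *)
(* At a maximizer the gradient vanishes, which reads
     s_p = sum_l (kh_pl G(t_p - t_l) + ka_pl (1 - G(t_l - t_p))) + gamma t_p,
   where G(z) is the expected score of a host with skill advantage z.  G is
   nondecreasing.  If the schedule is venue-balanced for p, or if the model is
   venue-neutral, this becomes s_p = sum_l k_pl F(t_p - t_l) + gamma t_p with F
   nondecreasing and independent of p.  Subtracting the equations of two
   schedule-equivalent players, all terms have the sign of t_i - t_j, and the
   prior term makes the comparison strict. *)
Require Import Defs.
From HB Require Import structures.
From mathcomp Require Import all_boot all_order all_algebra.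
From mathcomp Require Import reals.
From mathcomp.analysis Require Import sequences exp.
From mathcomp Require Import ring lra.
From mathcomp.classical Require Import boolp functions.
From mathcomp.analysis Require Import normedtype derive realfun.

Set Implicit Arguments.
Unset Strict Implicit.
Unset Printing Implicit Defensive.

Import Order.TTheory GRing.Theory Num.Theory.
Import numFieldNormedType.Exports.
Local Open Scope ring_scope.

Lemma is_derive_affine (R : realType) (a b x : R) :
  is_derive x 1 (fun t => a + b * t) b.
Proof.
have := is_deriveD (is_derive_cst a x 1) (is_deriveZ b (is_derive_id x (1 : R))).
by rewrite add0r scaler1.
Qed.

(** * Expected score of a host in the AC model, and its monotonicity *)

Section ExpectedScore.
Variables (R : realType) (L : nat) (alpha delta : 'I_L -> R).

Definition partition_function (z : R) : R :=
  \sum_(l < L) expR (alpha l + delta l * z).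

Definition expected_score (z : R) : R :=
  \sum_(y < L) delta y * home_prob alpha delta y z.

Lemma partition_function_gt0 (z : R) : (0 < L)%N -> 0 < partition_function z.
Proof.
rewrite /partition_function; case: L alpha delta => // n a d _.
rewrite big_ord_recl ltr_pwDl ?expR_gt0//.
by apply: sumr_ge0 => l _; exact: expR_ge0.
Qed.

Lemma expected_scoreE (z : R) :
  expected_score z =
  (\sum_(y < L) delta y * expR (alpha y + delta y * z)) / partition_function z.
Proof. by rewrite mulr_suml; apply: eq_bigr => y _; rewrite mulrA. Qed.

Lemma sum_home_prob (z : R) :
  (0 < L)%N -> \sum_(y < L) home_prob alpha delta y z = 1.
Proof.
by move=> L0; rewrite -mulr_suml divff// gt_eqF// (partition_function_gt0 z L0).
Qed.

(** Passing from [z] to [w] multiplies the weight of outcome [y] by [expR (delta y * (w - z))]. This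
    favours large slopes, so the mean slope cannot drop. *)
Lemma expected_score_le (z w : R) :
  (0 < L)%N -> z <= w -> expected_score z <= expected_score w.
Proof.
move=> L0 zw; rewrite !expected_scoreE.
rewrite ler_pdivrMr ?partition_function_gt0// mulrAC.
rewrite ler_pdivlMr ?partition_function_gt0// -subr_ge0 !big_distrlr /=.
pose e (y l : 'I_L) := expR (alpha y + delta y * w) * expR (alpha l + delta l * z).
rewrite [X in _ - X](_ : _ = \sum_(y < L) \sum_(l < L) delta y * e l y); last first.
  by apply: eq_bigr => y _; apply: eq_bigr => l _; rewrite /e mulrAC mulrA.
rewrite -sumrB.
under eq_bigr do rewrite -sumrB.
under eq_bigr do under eq_bigr do rewrite -mulrA -[expR _ * expR _]/(e _ _) -mulrBr.
(* Chebyshev's trick: antisymmetrizing in (y, l) makes every term nonnegative. *)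
set S := \sum_(y < L) _.
have S2 : S + S = \sum_(y < L) \sum_(l < L) (delta y - delta l) * (e y l - e l y).
  rewrite {2}/S exchange_big /= -big_split; apply: eq_bigr => y _ /=.
  by rewrite -big_split; apply: eq_bigr => l _ /=; ring.
suff : 0 <= S + S by lra.
rewrite S2; apply: sumr_ge0 => y _; apply: sumr_ge0 => l _.
(* The intercepts enter symmetrically, so [e y l - e l y] has the sign of
   [(delta y - delta l) * (w - z)]. *)
have eE a b : e a b = expR (alpha a + alpha b + delta a * w + delta b * z).
  by rewrite /e -expRD; congr expR; ring.
rewrite !eE; have [dyl|dly] := lerP (delta l) (delta y).
- by rewrite mulr_ge0 ?subr_ge0 ?ler_expR//; nra.
- by rewrite mulr_le0 ?subr_le0 ?ler_expR ?(ltW dly)//; nra.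
Qed.

(** Reversing the outcomes turns [home_prob] at [- z] into [away_prob] at [z], which neutrality
    identifies with [home_prob] at [z]. The slopes of paired outcomes then add up to 1. *)
Lemma expected_score_venue_neutral (z : R) :
    (0 < L)%N -> (forall y, delta y + delta (rev_ord y) = 1) ->
    venue_neutral alpha delta ->
  expected_score z + expected_score (- z) = 1.
Proof.
move=> L0 drev neutral; rewrite -(sum_home_prob z L0) /expected_score.
rewrite [X in _ + X](reindex_inj rev_ord_inj) -big_split /=.
apply: eq_bigr => y _.
rewrite -[home_prob _ _ (rev_ord y) _]/(away_prob _ _ y z) -neutral.
by rewrite -mulrDl drev mul1r.
Qed.

Lemma is_derive_partition_function (z : R) :
  is_derive z 1 partition_function
    (\sum_(y < L) delta y * expR (alpha y + delta y * z)).
Proof.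
pose h (l : 'I_L) (x : R) : R := expR (alpha l + delta l * x).
have -> : partition_function = \sum_(l < L) h l.
  by apply/funext => x; rewrite fct_sumE.
apply: is_derive_sum => l.
rewrite mulrC; exact: is_derive1_comp (is_derive_expR _) (is_derive_affine _ _ _).
Qed.

Lemma ln_home_probE (y : 'I_L) (z : R) :
  ln (home_prob alpha delta y z) = alpha y + delta y * z - ln (partition_function z).
Proof.
have L0 : (0 < L)%N by exact: leq_ltn_trans (leq0n y) (ltn_ord y).
by rewrite ln_div ?expRK// posrE ?expR_gt0// (partition_function_gt0 z L0).
Qed.

(** As in any exponential family, the logarithmic derivative of [partition_function] is the mean of
    the statistic, here [expected_score]. *)
Lemma is_derive_ln_home_prob (y : 'I_L) (z : R) :
  is_derive z 1 (fun x => ln (home_prob alpha delta y x))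
    (delta y - expected_score z).
Proof.
have L0 : (0 < L)%N by exact: leq_ltn_trans (leq0n y) (ltn_ord y).
under eq_fun do rewrite ln_home_probE.
have := is_derive1_comp (is_derive1_ln (partition_function_gt0 z L0))
  (is_derive_partition_function z).
rewrite mulrC -expected_scoreE => dpf.
exact: is_deriveB (is_derive_affine _ _ _) dpf.
Qed.

End ExpectedScore.

(** * Stationarity of the log-posterior at the MAP estimate *)

Section FirstOrder.
Variables (R : realType) (L M : nat) (alpha delta : 'I_L -> R).
Variables (kh : counts L M) (gamma : R).

(** The derivative of [log_posterior] at [theta] in the direction [v]. Working along lines keeps the
    calculus in one real variable. *)
Definition log_posterior_slope (theta v : 'rV[R]_M) : R :=
  \sum_(i < M) \sum_(j < M) \sum_(y < L)
    (kh y i j)%:R * ((v ord0 i - v ord0 j) *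
      (delta y - expected_score alpha delta (theta ord0 i - theta ord0 j)))
  - gamma * \sum_(i < M) theta ord0 i * v ord0 i.

Lemma is_derive_log_posterior (theta v : 'rV[R]_M) (t : R) :
  is_derive t 1
    (fun x => log_posterior alpha delta kh gamma (theta + x *: v))
    (log_posterior_slope (theta + t *: v) v).
Proof.
pose d (i j : 'I_M) := theta ord0 i - theta ord0 j.
pose c (i j : 'I_M) := v ord0 i - v ord0 j.
pose f (i j : 'I_M) (y : 'I_L) (x : R) : R :=
  (kh y i j)%:R * ln (home_prob alpha delta y (d i j + c i j * x)).
pose g (i : 'I_M) (x : R) : R := (theta ord0 i + v ord0 i * x) ^+ 2.
have dE i j x : (theta + x *: v) ord0 i - (theta + x *: v) ord0 j =
                d i j + c i j * x.
  by rewrite /d /c !mxE; ring.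
have -> : (fun x => log_posterior alpha delta kh gamma (theta + x *: v)) =
    \sum_(i < M) \sum_(j < M) \sum_(y < L) f i j y
    - (gamma / 2) \*: \sum_(i < M) g i.
  apply/funext => x; rewrite /log_posterior.
  rewrite !(fctE, fct_sumE) /=; congr (_ - _ * _).
    apply: eq_bigr => i _; rewrite fct_sumE; apply: eq_bigr => j _.
    by rewrite fct_sumE; apply: eq_bigr => y _; rewrite dE.
  by apply: eq_bigr => i _; rewrite /g !mxE (mulrC x).
apply: is_deriveB.
  apply: is_derive_sum => i; apply: is_derive_sum => j; apply: is_derive_sum => y.
  rewrite dE -/(c i j) [c i j * (_ - _)]mulrC.
  apply: is_deriveZ.
  exact: (@is_derive1_comp R (fun z => ln (home_prob alpha delta y z))
    (fun x => d i j + c i j * x) t _ _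
    (is_derive_ln_home_prob alpha delta y _) (is_derive_affine _ _ _)).
(* The factor 2 comes from differentiating the squares and cancels the denominator of
   [gamma / 2]. *)
have -> : gamma * \sum_(i < M) (theta + t *: v) ord0 i * v ord0 i =
    (gamma / 2) *: \sum_(i < M) 2 * ((theta + t *: v) ord0 i * v ord0 i).
  by rewrite -[RHS]/(_ * _) -mulr_sumr; field.
apply: is_deriveZ; apply: is_derive_sum => i.
have := is_deriveX 2 (is_derive_affine (theta ord0 i) (v ord0 i) t).
congr (is_derive _ _ _ _).
by rewrite -[LHS]/(_ * _) expr1 !mxE; ring.
Qed.

Lemma is_MAP_slope0 (theta v : 'rV[R]_M) :
  is_MAP alpha delta kh gamma theta -> log_posterior_slope theta v = 0.
Proof.
move=> map_theta.
have df := is_derive_log_posterior theta v 0.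
have df0 : is_derive (0 : R) 1
    (fun x => log_posterior alpha delta kh gamma (theta + x *: v)) 0.
  (* The maximum is global, so any open interval around 0 would serve. *)
  apply: (@derive1_at_max _ _ (-1) 1) => [|t _||t _]; first by lra.
  - by have [] := is_derive_log_posterior theta v t.
  - by rewrite in_itv /=; lra.
  - by rewrite scale0r addr0; exact: map_theta.
move: df; rewrite scale0r addr0 => df.
by rewrite -(@derive_val _ _ _ _ _ _ _ df) (@derive_val _ _ _ _ _ _ _ df0).
Qed.

(** Everything is indexed by the host's outcome: when [p] visits and the host gets [y], [p] earns
    [delta (rev_ord y) = 1 - delta y]. *)
Lemma score_home_away (p : 'I_M) :
    (forall y, delta y + delta (rev_ord y) = 1) ->
  score delta kh p = \sum_(l < M)
    \sum_(y < L) (delta y * (kh y p l)%:R + (1 - delta y) * (kh y l p)%:R).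
Proof.
move=> drev; rewrite exchange_big /=.
under [RHS]eq_bigr do rewrite big_split /=.
rewrite big_split /= [X in _ = _ + X](reindex_inj rev_ord_inj) -big_split /=.
apply: eq_bigr => y _; rewrite natr_sum mulr_sumr -big_split /=.
apply: eq_bigr => l _.
by rewrite natrD mulrDr -(drev (rev_ord y)) rev_ordK addrAC subrr add0r.
Qed.

Lemma away_matchesE (p l : 'I_M) : away_matches kh p l = home_matches kh l p.
Proof. by rewrite /home_matches (reindex_inj rev_ord_inj). Qed.

(** Stationarity in the direction of the basis vector of [p] involves only the matches of [p]: the
    excess of observed over expected score balances the pull of the prior. *)
Lemma score_is_MAP (theta : 'rV[R]_M) (p : 'I_M) :
    (forall y, delta y + delta (rev_ord y) = 1) ->
    is_MAP alpha delta kh gamma theta ->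
  score delta kh p =
  \sum_(l < M)
    ((home_matches kh p l)%:R *
       expected_score alpha delta (theta ord0 p - theta ord0 l)
     + (away_matches kh p l)%:R *
       (1 - expected_score alpha delta (theta ord0 l - theta ord0 p)))
  + gamma * theta ord0 p.
Proof.
move=> drev map_theta.
(* [A i j] is the observed minus expected score of [i] as host of [j]. *)
pose A (i j : 'I_M) := \sum_(y < L) (kh y i j)%:R *
  (delta y - expected_score alpha delta (theta ord0 i - theta ord0 j)).
have sum_at (f : 'I_M -> R) : \sum_(l < M) (l == p)%:R * f l = f p.
  rewrite (bigD1 p) //= eqxx mul1r big1 ?addr0// => l /negbTE ->.
  by rewrite mul0r.
have : \sum_(l < M) (A p l - A l p) = gamma * theta ord0 p.
  have /eqP := is_MAP_slope0 (delta_mx ord0 p) map_theta.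
  rewrite /log_posterior_slope subr_eq0 => /eqP.
  under [X in _ = _ * X]eq_bigr do rewrite mxE eqxx /= mulrC.
  rewrite sum_at => <-.
  (* A unit shift of the skill of [p] raises the differences where [p] hosts and lowers those where
     [p] visits, hence the opposite signs. *)
  transitivity (\sum_(i < M) \sum_(j < M)
      ((i == p)%:R * A i j - (j == p)%:R * A i j)).
    under [RHS]eq_bigr do rewrite sumrB -mulr_sumr sum_at.
    by rewrite !sumrB sum_at.
  apply: eq_bigr => i _; apply: eq_bigr => j _.
  rewrite -mulrBl mulr_sumr; apply: eq_bigr => y _.
  by rewrite !mxE eqxx /= mulrCA.
move=> <-; rewrite score_home_away// -big_split; apply: eq_bigr => l _ /=.
rewrite away_matchesE /home_matches !natr_sum !mulr_suml -!big_split /=.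
rewrite -sumrB -big_split.
by apply: eq_bigr => y _ /=; ring.
Qed.

End FirstOrder.

(** * From the score equations to the agreement of the two orders *)

Section ScoreOrder.
Variables (R : realType) (L M : nat) (delta : 'I_L -> R).
Variables (kh : counts L M) (gamma : R) (theta : 'rV[R]_M).

Lemma matchesC (p q : 'I_M) : matches kh p q = matches kh q p.
Proof. by rewrite /matches !away_matchesE addnC. Qed.

Lemma schedule_equivalentC (p q : 'I_M) :
  schedule_equivalent kh p q -> schedule_equivalent kh q p.
Proof. by move=> pq l lq lp; rewrite pq. Qed.

(** Common form of both cases of the theorem: [F] acts as an expected score per match in which the
    venue no longer appears. *)
Definition score_equation (F : R -> R) (p : 'I_M) : Prop :=
  score delta kh p =
  \sum_(l < M) (matches kh p l)%:R * F (theta ord0 p - theta ord0 l)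
  + gamma * theta ord0 p.

Lemma score_gap (F : R -> R) (p q : 'I_M) :
    {homo F : x y / x <= y} -> no_self_match kh -> p != q ->
    schedule_equivalent kh p q ->
    score_equation F p -> score_equation F q -> theta ord0 q <= theta ord0 p ->
  gamma * (theta ord0 p - theta ord0 q) <= score delta kh p - score delta kh q.
Proof.
move=> F_homo noself pq equiv -> -> qp.
have self r : matches kh r r = 0%N.
  by rewrite /matches away_matchesE /home_matches big1.
rewrite opprD addrACA -mulrBr lerDr subr_ge0.
(* Schedule equivalence is silent on the opponents [p] and [q], so they are split off: self-match
   terms vanish, and the two mutual terms carry the same weight by [matchesC]. *)
rewrite (bigD1 q) 1?eq_sym//= (bigD1 p)//= [leRHS](bigD1 p)//=.
rewrite [X in _ <= _ + X](bigD1 q) 1?eq_sym//=.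
rewrite !self !mul0r !add0r matchesC lerD//.
  by rewrite ler_wpM2l// F_homo//; lra.
under [leLHS]eq_bigl do rewrite andbC.
apply: ler_sum => l /andP[lp lq].
by rewrite equiv// ler_wpM2l// F_homo//; lra.
Qed.

Lemma score_order_skill_order (F : R -> R) (p q : 'I_M) :
    {homo F : x y / x <= y} -> 0 < gamma -> no_self_match kh -> p != q ->
    schedule_equivalent kh p q ->
    score_equation F p -> score_equation F q ->
  score delta kh q <= score delta kh p <-> theta ord0 q <= theta ord0 p.
Proof.
move=> F_homo gamma_gt0 noself pq equiv eqp eqq; split => [sqp|qp].
  rewrite leNgt; apply/negP => lt_pq.
  (* With the players exchanged, the bound makes the score of [q] strictly larger, against [sqp]. *)
  have := score_gap F_homo noself _ (schedule_equivalentC equiv) eqq eqp (ltW lt_pq).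
  rewrite eq_sym => /(_ pq) gap.
  have : 0 < gamma * (theta ord0 q - theta ord0 p) by rewrite mulr_gt0// subr_gt0.
  by lra.
have gap := score_gap F_homo noself pq equiv eqp eqq qp.
have : 0 <= gamma * (theta ord0 p - theta ord0 q).
  by rewrite mulr_ge0 ?(ltW gamma_gt0)// subr_ge0.
by lra.
Qed.

End ScoreOrder.

Theorem proposition1 (R : realType) (L M : nat) (hL : (2 <= L)%N)
    (alpha delta : 'I_L -> R) (hdelta : constant_sum_slopes delta)
    (kh : counts L M) (hkh : no_self_match kh)
    (gamma : R) (hgamma : 0 < gamma)
    (theta_hat : 'rV[R]_M) (hMAP : is_MAP alpha delta kh gamma theta_hat)
    (i j : 'I_M) (hij : i != j) :
  (schedule_equivalent kh i j -> venue_balanced kh i -> venue_balanced kh j ->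
     (score delta kh j <= score delta kh i <->
      theta_hat ord0 j <= theta_hat ord0 i))
  /\
  (venue_neutral alpha delta -> schedule_equivalent kh i j ->
     (score delta kh j <= score delta kh i <->
      theta_hat ord0 j <= theta_hat ord0 i)).
Proof.
have [_ _ _ drev] := hdelta.
have L_gt0 : (0 < L)%N := ltnW hL.
pose G := expected_score alpha delta.
split=> [equiv bal_i bal_j|neutral equiv].
(* Under venue balance half of the matches against each opponent are hosted, so [F] averages the
   expected scores as host and as visitor. *)
- pose F z := (G z + (1 - G (- z))) / 2.
  have F_homo : {homo F : x y / x <= y}.
    move=> x y xy; have : G x <= G y by exact: expected_score_le.
    have : G (- y) <= G (- x) by apply: expected_score_le => //; rewrite lerN2.
    by rewrite /F; lra.
  have eqF p : venue_balanced kh p -> score_equation delta kh gamma theta_hat F p.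
    move=> bal; rewrite /score_equation (score_is_MAP p drev hMAP).
    congr (_ + _); apply: eq_bigr => l _.
    by rewrite /matches -bal natrD /F opprB -!/(G _); field.
  exact: score_order_skill_order (eqF _ bal_i) (eqF _ bal_j).
- have G_homo : {homo G : x y / x <= y} by move=> x y; exact: expected_score_le.
  have eqG p : score_equation delta kh gamma theta_hat G p.
    rewrite /score_equation (score_is_MAP p drev hMAP).
    congr (_ + _); apply: eq_bigr => l _.
    (* Neutrality gives [1 - G (- z) = G z], so home and away matches contribute the same factor and
       their counts merge into [matches]. *)
    have := expected_score_venue_neutral
      (theta_hat ord0 p - theta_hat ord0 l) L_gt0 drev neutral.
    by rewrite opprB /matches natrD /G => /(canRL (addrK _)) ->; ring.
  exact: score_order_skill_order (eqG _) (eqG _).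
Qed.
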